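(* Let $(\Omega,\mathcal A,\mathbb P)$ be a probability space and let $\psi\colon[0,+\infty)\to[0,+\infty)$ be an Orlicz function such that $$\lim_{x\to+\infty}\frac{\psi(2x)}{\psi(x)}=+\infty .$$ Let $X_0$ be a linear subspace of $L^\infty(\Omega)$ on which the norms $\|\cdot\|_2$ and $\|\cdot\|_\psi$ are not equivalent. Then there exists in $X_0$ a sequence which is equivalent, in the closure $X$ of $X_0$ in $L^\psi(\Omega)$ for the norm $\|\cdot\|_\psi$, to the canonical basis of $c_0$.
   Context: An Orlicz function is an increasing convex function $\psi\colon[0,+\infty)\to[0,+\infty)$ with $\psi(0)=0$ and $\psi(+\infty)=+\infty$ (i.e. $\lim_{x\to+\infty}\psi(x)=+\infty$). The Orlicz space $L^\psi(\Omega)$ is the space of all (equivalence classes of) measurable functions $f\colon\Omega\to\mathbb C$ for which there is a constant $C\ge 0$ such that $\int_\Omega\psi(|f(t)|/C)\,d\mathbb P(t)\le 1$; $\|f\|_\psi$ is the least such constant $C$. Under the growth assumption on $\psi$, one has $L^\infty(\Omega)\subseteq L^\psi(\Omega)\subseteq L^2(\Omega)$ with continuous inclusions. $\|\cdot\|_2$ is the norm of $L^2(\Omega)$. *)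

(* Defs.v *)
From HB Require Import structures.
From mathcomp Require Import all_boot all_order all_algebra.
From mathcomp Require Export complex.
From mathcomp Require Export all_classical all_reals all_analysis.
Import Order.TTheory GRing.Theory Num.Theory.
Import numFieldNormedType.Exports.

Set Implicit Arguments.
Unset Strict Implicit.
Unset Printing Implicit Defensive.

Local Open Scope classical_set_scope.
Local Open Scope ring_scope.

Definition cmod (R : realType) (z : R[i]) : R := ComplexField.Normc.normc z.

Definition cmeasurable (d : measure_display) (T : measurableType d)
    (R : realType) (f : T -> R[i]) : Prop :=
  measurable_fun setT (fun x => complex.Re (f x)) /\
  measurable_fun setT (fun x => complex.Im (f x)).

(* Only the values of psi on [0, +oo[ matter. "Increasing" is taken in the wide
   sense, so strictly increasing functions are included. *)
Definition orlicz_function (R : realType) (psi : R -> R) : Prop :=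
  [/\ forall x, 0 <= x -> 0 <= psi x,
      {in `[0, +oo[ &, {homo psi : x y / x <= y}},
      convex_function (`[0, +oo[%classic : set R^o) psi,
      psi 0 = 0
    & psi x @[x --> +oo] --> +oo].

(* The constant C ranges over ]0, +oo[: as x / 0 = 0 in MathComp, C = 0 would
   otherwise be admissible for every f. *)
Definition orlicz_bound (d : measure_display) (T : measurableType d)
    (R : realType) (P : probability T R) (psi : R -> R)
    (f : T -> R[i]) : set R :=
  [set C | 0 < C /\ (\int[P]_t (psi (cmod (f t) / C))%:E <= 1%:E)%E].

Definition orlicz_space (d : measure_display) (T : measurableType d)
    (R : realType) (P : probability T R) (psi : R -> R) : set (T -> R[i]) :=
  [set f | cmeasurable f /\ orlicz_bound P psi f !=set0].

Definition orlicz_norm (d : measure_display) (T : measurableType d)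
    (R : realType) (P : probability T R) (psi : R -> R)
    (f : T -> R[i]) : \bar R :=
  ereal_inf [set C%:E | C in orlicz_bound P psi f].

Definition norm2 (d : measure_display) (T : measurableType d)
    (R : realType) (P : probability T R) (f : T -> R[i]) : \bar R :=
  Lnorm P 2%:E (fun t => (cmod (f t))%:E).

Definition Linfty (d : measure_display) (T : measurableType d)
    (R : realType) (P : probability T R) : set (T -> R[i]) :=
  [set f | cmeasurable f /\ (Lnorm P +oo (fun t => (cmod (f t))%:E) < +oo)%E].

(* Spaces of classes of functions modulo almost everywhere equality are
   represented by the sets of all the representatives of their elements; this
   is the purpose of the last clause. *)
Definition linear_subspace_Linfty (d : measure_display) (T : measurableType d)
    (R : realType) (P : probability T R) (X0 : set (T -> R[i])) : Prop :=
  [/\ X0 `<=` Linfty P,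
      X0 (fun _ => 0),
      forall (k : R[i]) f g, X0 f -> X0 g -> X0 (fun t => k * f t + g t)
    & forall f g, X0 f -> cmeasurable g -> ae_eq P setT f g -> X0 g].

Definition equivalent_norms (V : Type) (R : realType) (E : set V)
    (N1 N2 : V -> \bar R) : Prop :=
  exists c C : R, [/\ 0 < c, 0 < C &
    forall v, E v -> (c%:E * N1 v <= N2 v)%E /\ (N2 v <= C%:E * N1 v)%E].

Definition orlicz_closure (d : measure_display) (T : measurableType d)
    (R : realType) (P : probability T R) (psi : R -> R)
    (X0 : set (T -> R[i])) : set (T -> R[i]) :=
  [set g | orlicz_space P psi g /\
     forall e : R, 0 < e -> exists2 f, X0 f &
       (orlicz_norm P psi (fun t => g t - f t)%R < e%:E)%E].

Definition c0_space (R : realType) : set (nat -> R[i]) :=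
  [set a | cmod (a n) @[n --> \oo] --> (0 : R)].

Definition sup_norm (R : realType) (a : nat -> R[i]) : \bar R :=
  ereal_sup (range (fun n => (cmod (a n))%:E)).

Definition c0_basis (R : realType) (n : nat) : nat -> R[i] :=
  fun k => (k == n)%:R.

(* (f n) is equivalent in X, a space normed by the Orlicz norm, to the canonical
   basis of c_0: some isomorphism J of c_0 onto a subspace of X maps the n-th
   vector of the canonical basis to f n. Identities in X hold almost everywhere.
   On finitely supported sequences a, the norm estimate reads
   c * max |a_k| <= || \sum_k a_k f_k || <= C * max |a_k|. *)
Definition equivalent_to_c0_basis (d : measure_display) (T : measurableType d)
    (R : realType) (P : probability T R) (psi : R -> R)
    (X : set (T -> R[i])) (f : nat -> T -> R[i]) : Prop :=
  exists J : (nat -> R[i]) -> (T -> R[i]),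
  [/\ forall a, c0_space a -> X (J a),
      forall (k : R[i]) a b, c0_space a -> c0_space b ->
        ae_eq P setT (J (fun n => k * a n + b n))
                     (fun t => k * J a t + J b t),
      equivalent_norms (@c0_space R) (@sup_norm R)
        (fun a => orlicz_norm P psi (J a))
    & forall n, ae_eq P setT (J (c0_basis R n)) (f n)].

(* Main.v *)
Require Import Defs.
From mathcomp Require Import all_boot all_order all_algebra.
From mathcomp Require Import all_classical all_reals all_analysis.
From mathcomp Require Import measurable_realfun ess_sup_inf.
From mathcomp Require Import ring lra.
Import Order.TTheory GRing.Theory Num.Theory.
Import numFieldNormedType.Exports.
Local Open Scope classical_set_scope.
Local Open Scope ring_scope.

(* The growth condition makes the Orlicz norm dominate the L^2 norm, so the
   failure of equivalence provides functions of X0 of Orlicz norm about 1 whose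
   L^2 norm, hence whose distribution outside a tiny set, is arbitrarily small.
   Choose such f_0, f_1, ... successively, f_n being at most 2^-(n+1) outside a
   set A_n whose measure is tiny compared with the bounds of f_0, ..., f_(n-1).
   If n is the last index with t in A_n, then \sum_k |f_k t| <= B_n + |f_n t|.
   Where |f_n| <= B_n, the smallness of A_n controls psi of this sum; elsewhere
   the sum is at most 2 |f_n| and psi (|f_n| / 2) <= 2^-(n+1) psi |f_n|. Hence
   \sum_k |f_k| has finite Orlicz norm, which gives the upper c_0 estimate. For
   the lower one, on the part of A_j outside all later A_m where
   |f_j| >= 4 B_j, the term a_j f_j dominates \sum_k a_k f_k, and this part
   carries most of the Orlicz norm of f_j. *)

(** * Modulus, real part and imaginary part of complex numbers *)

Section Modulus.
Context {R : realType}.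
Implicit Types z w : R[i].

Lemma cmod_ge0 z : 0 <= cmod z.
Proof. by case: z => a b; exact: sqrtr_ge0. Qed.

Lemma cmodE z : cmod z = Num.sqrt (complex.Re z ^+ 2 + complex.Im z ^+ 2).
Proof. by case: z. Qed.

Lemma cmod0 : cmod (0 : R[i]) = 0.
Proof. exact: ComplexField.Normc.normc0. Qed.

Lemma cmod1 : cmod (1 : R[i]) = 1.
Proof. exact: ComplexField.Normc.normc1. Qed.

Lemma cmodM z w : cmod (z * w) = cmod z * cmod w.
Proof. exact: ComplexField.Normc.normcM. Qed.

Lemma cmodN z : cmod (- z) = cmod z.
Proof. exact: normcN. Qed.

Lemma cmodD z w : cmod (z + w) <= cmod z + cmod w.
Proof. exact: le_normcD. Qed.

Lemma cmodB z w : cmod z - cmod w <= cmod (z - w).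
Proof. by rewrite lerBlDr (le_trans _ (cmodD _ _)) ?subrK. Qed.

Lemma cmod_real (x : R) : 0 <= x -> cmod (x%:C)%C = x.
Proof. by move=> x0; rewrite cmodE /= expr0n addr0 sqrtr_sqr ger0_norm. Qed.

Lemma cReD z w : complex.Re (z + w) = complex.Re z + complex.Re w.
Proof. by case: z; case: w. Qed.

Lemma cImD z w : complex.Im (z + w) = complex.Im z + complex.Im w.
Proof. by case: z; case: w. Qed.

Lemma cReM z w : complex.Re (z * w) =
  complex.Re z * complex.Re w - complex.Im z * complex.Im w.
Proof. by case: z; case: w. Qed.

Lemma cImM z w : complex.Im (z * w) =
  complex.Re z * complex.Im w + complex.Im z * complex.Re w.
Proof. by case: z; case: w. Qed.

Lemma cReN z : complex.Re (- z) = - complex.Re z.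
Proof. by case: z. Qed.

Lemma cImN z : complex.Im (- z) = - complex.Im z.
Proof. by case: z. Qed.

Lemma Re_sum I (s : seq I) (F : I -> R[i]) :
  complex.Re (\sum_(k <- s) F k) = \sum_(k <- s) complex.Re (F k).
Proof. by apply: (big_morph _ cReD). Qed.

Lemma Im_sum I (s : seq I) (F : I -> R[i]) :
  complex.Im (\sum_(k <- s) F k) = \sum_(k <- s) complex.Im (F k).
Proof. by apply: (big_morph _ cImD). Qed.

Lemma cmod_sum I (s : seq I) (F : I -> R[i]) :
  cmod (\sum_(k <- s) F k) <= \sum_(k <- s) cmod (F k).
Proof.
elim/big_ind2 : _ => [|x1 x2 y1 y2 ? ?|//]; first by rewrite cmod0.
by rewrite (le_trans (cmodD _ _))// lerD.
Qed.

Lemma Re_le_cmod z : `|complex.Re z| <= cmod z.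
Proof. by rewrite cmodE -sqrtr_sqr ler_wsqrtr// lerDl sqr_ge0. Qed.

Lemma Im_le_cmod z : `|complex.Im z| <= cmod z.
Proof. by rewrite cmodE -sqrtr_sqr ler_wsqrtr// lerDr sqr_ge0. Qed.

End Modulus.

#[local] Hint Extern 0 (is_true (0 <= cmod _)) =>
  solve [apply: cmod_ge0] : core.

(** * Convexity and growth of Orlicz functions *)

Section Orlicz.
Context {R : realType} {psi : R -> R}.
Hypothesis psi_orlicz : orlicz_function psi.

Lemma orlicz_ge0 x : 0 <= x -> 0 <= psi x.
Proof. by case: psi_orlicz => + _ _ _ _; apply. Qed.

Lemma orlicz_le x y : 0 <= x -> x <= y -> psi x <= psi y.
Proof.
case: psi_orlicz => _ h _ _ _ x0 xy; apply: h => //; rewrite in_itv/= andbT//.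
exact: le_trans xy.
Qed.

(** Convexity between [x] and [0], where [psi] vanishes. *)
Lemma orlicz_scale t x : 0 <= t -> t <= 1 -> 0 <= x -> psi (t * x) <= t * psi x.
Proof.
case: psi_orlicz => _ _ cvx psi0 _ t0 t1 x0.
have nneg y : 0 <= y -> y \in (`[0, +oo[%classic : set R).
  by move=> y0; apply/mem_set; rewrite /= in_itv/= andbT.
have : psi (t * x + (1 - t) * 0) <= t * psi x + (1 - t) * psi 0.
  exact: cvx (Itv01 t0 t1) x 0 (nneg _ x0) (nneg _ (lexx _)).
by rewrite psi0 !mulr0 !addr0.
Qed.

Lemma orlicz_div k x : 1 <= k -> 0 <= x -> psi (x / k) <= psi x / k.
Proof.
move=> k1 x0; have k0 : 0 < k by exact: lt_le_trans k1.
by rewrite ![_ / k]mulrC orlicz_scale// ?invr_ge0 ?(ltW k0)// invf_le1.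
Qed.

Lemma orlicz_unbounded M : exists2 x0, 0 < x0 & forall x, x0 <= x -> M < psi x.
Proof.
case: psi_orlicz => _ _ _ _ /cvgryPgt/(_ M) [x0 [_ h]].
exists (Num.max x0 0 + 1) => [|x hx].
  by rewrite ltr_wpDl// le_max lexx orbT.
by apply: h; rewrite (lt_le_trans _ hx)// ltr_pwDr// le_max lexx.
Qed.

Hypothesis psi_growth : psi (2 * x) / psi x @[x --> +oo] --> +oo.

Lemma orlicz_doubling M :
  exists2 x0, 0 < x0 & forall x, x0 <= x -> M * psi x <= psi (2 * x).
Proof.
(* From [x1] on [psi] is positive, so the quotient in the growth condition can be cleared. *)
have [x1 x10 h1] := orlicz_unbounded 0.
have /cvgryPge/(_ M) [x0 [_ h]] := psi_growth.
exists (Num.max x0 x1 + 1) => [|x hx].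
  by rewrite addr_gt0// lt_max x10 orbT.
have x1x : x1 <= x by rewrite (le_trans _ hx)// ler_wpDr// le_max lexx orbT.
rewrite -ler_pdivlMr ?h1//; apply: h.
by rewrite (lt_le_trans _ hx)// ltr_pwDr// le_max lexx.
Qed.

(** Far out, doubling the argument multiplies [psi] by at least 4 and the square by exactly 4, so a
    quadratic lower bound on one dyadic interval propagates to all larger ones. This is what makes
    the Orlicz norm control the L^2 norm. *)
Lemma orlicz_square :
  exists c x0, [/\ 0 < c, 0 < x0 & forall x, x0 <= x -> c * x ^+ 2 <= psi x].
Proof.
have [x1 x10 h1] := orlicz_unbounded 0.
have [x2 x20 h2] := orlicz_doubling 4.
pose x0 := Num.max x1 x2.
have x00 : 0 < x0 by rewrite lt_max x10.
have x1x0 : x1 <= x0 by rewrite le_max lexx.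
have x2x0 : x2 <= x0 by rewrite le_max lexx orbT.
have c0 : 0 < psi x0 / (2 * x0) ^+ 2.
  by rewrite divr_gt0 ?exprn_gt0 ?mulr_gt0// h1.
(* By monotonicity of [psi] this constant works on the first interval [x0, 2 x0]. *)
exists (psi x0 / (2 * x0) ^+ 2), x0; split=> // x x0x.
(* The induction is on a number of doublings sufficient to pass from [x0] beyond [x]. *)
have [n xn] : exists n : nat, x <= 2 ^+ n * x0.
  exists (Num.truncn (x / x0)).+1; rewrite -ler_pdivrMr//.
  rewrite (le_trans (ltW (truncnS_gt _)))// -natrX ler_nat.
  exact/ltnW/ltn_expl.
elim: n x x0x xn => [x x0x|n ih x x0x xn].
  rewrite mul1r => xx0.
  rewrite (@le_trans _ _ (psi x0))//;
    last exact: orlicz_le (ltW _) _.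
  rewrite mulrAC ler_pdivrMr ?exprn_gt0 ?mulr_gt0// ler_pM2l ?h1//.
  by rewrite ler_pXn2r ?nnegrE ?(le_trans _ x0x) ?mulr_ge0// ?ltW//
    (le_lt_trans xx0)// ltr_pMl// ltr1n.
have [xx0|/ltW x0x'] := leP x (2 * x0).
  rewrite (@le_trans _ _ (psi x0))//;
    last exact: orlicz_le (ltW _) _.
  rewrite mulrAC ler_pdivrMr ?exprn_gt0 ?mulr_gt0// ler_pM2l ?h1//.
  by rewrite ler_pXn2r ?nnegrE ?(le_trans _ x0x) ?mulr_ge0// ltW.
have hx : x0 <= x / 2 by rewrite ler_pdivlMr// mulrC.
have -> : x = 2 * (x / 2) by field.
rewrite (le_trans _ (h2 _ (le_trans x2x0 hx)))//.
set c := psi x0 / _ in c0 ih *.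
rewrite exprMn mulrCA (_ : 2 ^+ 2 = 4 :> R); last by ring.
rewrite ler_pM2l// ih// ler_pdivrMr// (le_trans xn)//.
by rewrite exprS -mulrA mulrC.
Qed.

End Orlicz.

(** * Measurability of complex-valued functions *)

Section Measurability.
Context {R : realType} {d : measure_display} {T : measurableType d}.
Implicit Types f g : T -> R[i].

Lemma cmeasurable_cst (k : R[i]) : cmeasurable (fun _ : T => k).
Proof. by split; exact: measurable_cst. Qed.

Lemma cmeasurableD f g :
  cmeasurable f -> cmeasurable g -> cmeasurable (fun t => f t + g t).
Proof.
move=> [f1 f2] [g1 g2]; split.
- by under eq_fun do rewrite cReD; exact: measurable_funD.
- by under eq_fun do rewrite cImD; exact: measurable_funD.
Qed.

Lemma cmeasurableM f g :
  cmeasurable f -> cmeasurable g -> cmeasurable (fun t => f t * g t).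
Proof.
move=> [f1 f2] [g1 g2]; split.
- under eq_fun do rewrite cReM.
  by apply: measurable_funB; exact: measurable_funM.
- under eq_fun do rewrite cImM.
  by apply: measurable_funD; exact: measurable_funM.
Qed.

Lemma cmeasurable_sum (f_ : nat -> T -> R[i]) N :
  (forall k, cmeasurable (f_ k)) ->
  cmeasurable (fun t => \sum_(0 <= k < N) f_ k t : R[i]).
Proof.
move=> mf; elim: N => [|N ih].
  by under eq_fun do rewrite big_geq//; exact: cmeasurable_cst.
by under eq_fun do rewrite big_nat_recr//=; exact: cmeasurableD.
Qed.

Lemma measurable_cmod f :
  cmeasurable f -> measurable_fun setT (fun t => cmod (f t)).
Proof.
move=> [f1 f2]; under eq_fun do rewrite cmodE.
apply: (@measurableT_comp _ _ _ _ _ _ (@Num.sqrt R)).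
  by apply: nondecreasing_measurable => // x y; exact: ler_wsqrtr.
by apply: measurable_funD; exact: measurable_funX.
Qed.

Lemma measurable_orlicz (psi : R -> R) (g : T -> R) : orlicz_function psi ->
  (forall t, 0 <= g t) -> measurable_fun setT g ->
  measurable_fun setT (fun t => (psi (g t))%:E).
Proof.
move=> psiO g0 mg; apply/measurable_EFinP.
(* [psi] is monotone only on the half-line; precomposed with the positive part it is monotone
   everywhere, hence measurable. *)
have -> : (fun t => psi (g t)) = (fun x => psi (Num.max x 0)) \o g.
  by apply/funext => t /=; rewrite max_l.
apply: measurableT_comp => //; apply: nondecreasing_measurable => // x y xy.
apply: orlicz_le => //; first by rewrite le_max lexx orbT.
by rewrite ge_max !le_max xy lexx orbT.
Qed.

Lemma measurable_orlicz_cmod (psi : R -> R) f c : orlicz_function psi ->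
  0 <= c -> cmeasurable f ->
  measurable_fun setT (fun t => (psi (cmod (f t) * c))%:E).
Proof.
move=> psiO c0 mf; apply: measurable_orlicz => //.
  by move=> t; rewrite mulr_ge0// cmod_ge0.
by apply: measurable_funM => //; exact: measurable_cmod.
Qed.

End Measurability.

(** * The L^2, Orlicz and L^infinity norms *)

Section Norms.
Context {R : realType} {d : measure_display} {T : measurableType d}.
Variable P : probability T R.
Implicit Types f g : T -> R[i].

Lemma integral_cst_prob (r : R) : (\int[P]_t r%:E = r%:E)%E.
Proof.
rewrite integral_cst//; have := probability_setT P.
by move=> /= ->; rewrite mule1.
Qed.

Lemma norm2E f :
  norm2 P f = ((\int[P]_t (cmod (f t) ^+ 2)%:E) `^ 2^-1)%E.
Proof.
rewrite /norm2 unlock; congr poweR; apply: eq_integral => t _.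
by rewrite /= powR_mulrn// ger0_norm.
Qed.

Lemma norm2_leP f (r : R) : 0 <= r ->
  (\int[P]_t (cmod (f t) ^+ 2)%:E <= (r ^+ 2)%:E)%E <-> (norm2 P f <= r%:E)%E.
Proof.
move=> r0; rewrite norm2E.
have : (0 <= \int[P]_t (cmod (f t) ^+ 2)%:E)%E.
  by apply: integral_ge0 => t _; rewrite lee_fin exprn_ge0.
case: (\int[P]_t _)%E => [n||];
  [|by rewrite poweRyr ?invr_neq0// !leye_eq|by []].
rewrite poweR_EFin !lee_fin => n0.
by rewrite powR12_sqrt// -{2}(ger0_norm r0) -sqrtr_sqr ler_sqrt ?exprn_ge0.
Qed.

Lemma ae_eq_integral_cmod (phi : R -> R) f g :
  (forall x, 0 <= x -> 0 <= phi x) ->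
  measurable_fun setT (fun t => (phi (cmod (f t)))%:E) ->
  measurable_fun setT (fun t => (phi (cmod (g t)))%:E) ->
  ae_eq P setT f g ->
  (\int[P]_t (phi (cmod (f t)))%:E = \int[P]_t (phi (cmod (g t)))%:E)%E.
Proof.
move=> phi0 mf mg fg; apply: ge0_ae_eq_integral => //.
- by move=> t _; rewrite lee_fin phi0.
- by move=> t _; rewrite lee_fin phi0.
- by apply: filterS fg => t /= /[apply] ->.
Qed.

Lemma measurable_cmod_sqr f : cmeasurable f ->
  measurable_fun setT (fun t => (cmod (f t) ^+ 2)%:E).
Proof.
by move=> mf; apply/measurable_EFinP/measurable_funX; exact: measurable_cmod.
Qed.

Lemma ae_eq_norm2 f g : cmeasurable f -> cmeasurable g ->
  ae_eq P setT f g -> norm2 P f = norm2 P g.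
Proof.
move=> mf mg fg; rewrite !norm2E; congr poweR.
apply: (ae_eq_integral_cmod (fun x => x ^+ 2)) => //.
- by move=> x; exact: exprn_ge0.
- exact: measurable_cmod_sqr.
- exact: measurable_cmod_sqr.
Qed.

Lemma ae_eq_orlicz_bound psi f g : orlicz_function psi ->
  cmeasurable f -> cmeasurable g -> ae_eq P setT f g ->
  orlicz_bound P psi f = orlicz_bound P psi g.
Proof.
move=> psiO mf mg fg; apply/seteqP.
have E c : 0 < c -> (\int[P]_t (psi (cmod (f t) / c))%:E =
    \int[P]_t (psi (cmod (g t) / c))%:E)%E.
  move=> c0; apply: (ae_eq_integral_cmod (fun x => psi (x / c))) => //.
  - by move=> x x0; rewrite (orlicz_ge0 psiO)// divr_ge0// ltW.
  - by apply: measurable_orlicz_cmod; rewrite // invr_ge0 ltW.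
  - by apply: measurable_orlicz_cmod; rewrite // invr_ge0 ltW.
by split=> c [c0 h]; split=> //; [rewrite -E|rewrite E].
Qed.

Lemma chebyshev_norm2 f (a r : R) : cmeasurable f -> 0 < a -> 0 <= r ->
  (norm2 P f <= r%:E)%E ->
  (P [set t | (a <= cmod (f t))%R] <= ((r / a) ^+ 2)%:E)%E.
Proof.
move=> mf a0 r0 /norm2_leP-/(_ r0) fr.
have := @le_integral_abse _ _ _ P _ measurableT _ (a ^+ 2)
  (measurable_cmod_sqr _ mf) (exprn_gt0 _ a0).
under eq_integral do rewrite gee0_abs ?lee_fin ?exprn_ge0//.
move=> /le_trans-/(_ _ fr); rewrite setTI.
rewrite [X in (_ * P X)%E](_ : _ = [set t | a <= cmod (f t)]).
  by rewrite muleC -lee_pdivlMr ?exprn_gt0// -EFinM expr_div_n.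
apply/seteqP; split=> t /=;
  by rewrite ger0_norm ?exprn_ge0// lee_fin ler_pXn2r ?nnegrE// ltW.
Qed.

(** Where |f| / c is at least the threshold [x0] of [orlicz_square], [psi] controls the square;
    elsewhere |f| is at most c x0. Integration bounds the squared L^2 norm by (x0^2 + 1/k) c^2. *)
Lemma norm2_le_orlicz psi : orlicz_function psi ->
  psi (2 * x) / psi x @[x --> +oo] --> +oo ->
  exists2 K, 0 < K & forall f c, cmeasurable f -> orlicz_bound P psi f c ->
    (norm2 P f <= (K * c)%:E)%E.
Proof.
move=> psiO psi_growth.
have [k [x0 [k0 x00 hk]]] := orlicz_square psiO psi_growth.
(* The added 1 gives K >= 1, so that x0^2 + 1/k <= K <= K^2. *)
exists (x0 ^+ 2 + k^-1 + 1) => [|f c mf [c0 fc]].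
  by rewrite !addr_gt0 ?invr_gt0 ?exprn_gt0.
set K := _ + _ + 1; have K1 : 1 <= K.
  by rewrite lerDr addr_ge0 ?invr_ge0 ?exprn_ge0 ?ltW.
have Kc0 : 0 <= K * c by rewrite mulr_ge0 ?(ltW c0)// (le_trans _ K1).
apply/norm2_leP => //.
have ptw t : cmod (f t) ^+ 2 <=
    c ^+ 2 * x0 ^+ 2 + (c ^+ 2 / k) * psi (cmod (f t) / c).
  have fc0 : 0 <= cmod (f t) / c by rewrite divr_ge0// ltW.
  have [fx|/ltW fx] := leP x0 (cmod (f t) / c).
    rewrite ler_wpDl ?mulr_ge0 ?exprn_ge0 ?(ltW c0) ?(ltW x00)//.
    rewrite (@le_trans _ _ (c ^+ 2 / k * (k * (cmod (f t) / c) ^+ 2)))//.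
      by rewrite expr_div_n mulrA divfK ?gt_eqF// mulrC divfK// gt_eqF
        ?exprn_gt0.
    by rewrite ler_pM2l ?hk// divr_gt0 ?exprn_gt0.
  apply: ler_wpDr.
    by rewrite mulr_ge0 ?divr_ge0 ?exprn_ge0 ?(ltW c0) ?(ltW k0)
      ?(orlicz_ge0 psiO).
  rewrite -exprMn ler_pXn2r ?nnegrE ?mulr_ge0 ?(ltW c0) ?(ltW x00)//.
  by rewrite mulrC -ler_pdivrMr.
have psi0 t : 0 <= psi (cmod (f t) / c).
  by rewrite (orlicz_ge0 psiO)// divr_ge0// ltW.
have mpsi : measurable_fun [set: T] (fun t => (psi (cmod (f t) / c))%:E).
  by apply: measurable_orlicz_cmod; rewrite // invr_ge0 ltW.
apply: (@le_trans _ _ (\int[P]_t ((c ^+ 2 * x0 ^+ 2)%:E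
    + (c ^+ 2 / k)%:E * (psi (cmod (f t) / c))%:E))%E).
  apply: ge0_le_integral => //.
  - by move=> t _; rewrite lee_fin exprn_ge0.
  - exact: measurable_cmod_sqr.
  - by apply: emeasurable_funD => //; exact: measurable_funeM.
  - by move=> t _; rewrite -EFinM -EFinD lee_fin.
have ck0 : 0 <= c ^+ 2 / k by rewrite divr_ge0 ?exprn_ge0 ?ltW.
rewrite ge0_integralD//; first last.
- exact: measurable_funeM.
- by move=> t _; rewrite mule_ge0// lee_fin.
- by move=> t _; rewrite lee_fin mulr_ge0 ?exprn_ge0 ?ltW.
rewrite integral_cst_prob ge0_integralZl_EFin//; last first.
  by move=> t _; rewrite lee_fin.
rewrite (@le_trans _ _ ((c ^+ 2 * x0 ^+ 2)%:E + (c ^+ 2 / k)%:E * 1)%E)//.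
  by rewrite leeD2l// lee_wpmul2l.
rewrite mule1 lee_fin -mulrDr exprMn mulrC ler_pM2r ?exprn_gt0//.
rewrite (@le_trans _ _ K)//; first by rewrite lerDl.
by rewrite ler_eXnr.
Qed.

(** Setting [f] to 0 where its modulus exceeds a real bound of the essential supremum changes it on
    a null set only. *)
Lemma Linfty_bounded f : Linfty P f -> exists M g,
  [/\ 0 <= M, cmeasurable g, ae_eq P setT f g & forall t, cmod (g t) <= M].
Proof.
move=> [mf]; rewrite unlock /= probability_setT lte01.
set s := ess_sup _ _ => sy.
have [M M0 sM] : exists2 M, 0 <= M & (s <= M%:E)%E.
  case: s sy => [s||]// _; last by exists 0 => //; exact: leNye.
  by exists (Num.max s 0); rewrite ?lee_fin le_max lexx ?orbT.
have mS : measurable [set t | cmod (f t) <= M].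
  rewrite [X in measurable X](_ : _ = (fun t => cmod (f t)) @^-1` `]-oo, M]).
    by rewrite -[X in measurable X]setTI; apply: measurable_cmod.
  by apply/seteqP; split => t /=; rewrite in_itv.
exists M, (fun t => f t * ((\1_[set t | cmod (f t) <= M] t)%:C)%C).
have E t : cmod (f t) <= M ->
    f t * ((\1_[set t | cmod (f t) <= M] t)%:C)%C = f t.
  by move=> fM; rewrite indicE mem_set// mulr1.
split=> //.
- apply: cmeasurableM => //; split=> /=; last exact: measurable_cst.
  exact: measurable_indic.
- apply: filterS (ess_sup_ge P (abse \o fun t => (cmod (f t))%:E)) => t /= h _.
  rewrite E//; move: (le_trans h sM); rewrite lee_fin.
  by apply: le_trans; exact: ler_norm.
- move=> t; have [fM|/negP fM] := boolP (cmod (f t) <= M); first by rewrite E.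
  by rewrite indicE memNset// mulr0 cmod0.
Qed.

End Norms.

(** * Functions of small L^2 norm and large Orlicz norm *)

Section Unbalanced.
Context {R : realType} {d : measure_display} {T : measurableType d}.
Context {P : probability T R} {psi : R -> R} {X0 : set (T -> R[i])}.
Hypothesis psi_orlicz : orlicz_function psi.
Hypothesis psi_growth : psi (2 * x) / psi x @[x --> +oo] --> +oo.
Hypothesis X0_subspace : linear_subspace_Linfty P X0.

Lemma subspace_cmeasurable f : X0 f -> cmeasurable f.
Proof. by case: X0_subspace => h _ _ _ /h []. Qed.

Lemma subspaceZ (k : R[i]) f : X0 f -> X0 (fun t => k * f t).
Proof.
case: X0_subspace => _ X00 lin _ X0f.
by have := lin k _ _ X0f X00; under eq_fun do rewrite addr0.
Qed.

Lemma subspace_sum (a : nat -> R[i]) (f : nat -> T -> R[i]) N :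
  (forall k, X0 (f k)) -> X0 (fun t => \sum_(0 <= k < N) a k * f k t).
Proof.
case: X0_subspace => _ X00 lin _ X0f; elim: N => [|N ih].
  by under eq_fun do rewrite big_geq//.
under eq_fun do rewrite big_nat_recr//= addrC.
exact: lin.
Qed.

Lemma orlicz_norm_le (f : T -> R[i]) c :
  orlicz_bound P psi f c -> (orlicz_norm P psi f <= c%:E)%E.
Proof. by move=> fc; apply: ereal_inf_lbound; exists c. Qed.

Lemma bounded_orlicz_bound (f : T -> R[i]) M : cmeasurable f ->
  (forall t, cmod (f t) <= M) -> orlicz_bound P psi f !=set0.
Proof.
(* Since psi (x / c) <= psi x / c for c >= 1, this [c] brings the integrand below 1. *)
move=> mf fM; pose c := 1 + psi (Num.max M 0).
have M0 : 0 <= Num.max M 0 by rewrite le_max lexx orbT.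
have psi0 := orlicz_ge0 psi_orlicz _ M0.
have c1 : 1 <= c by rewrite lerDl.
have c0 : 0 < c by exact: lt_le_trans c1.
exists c; split=> //.
rewrite -(integral_cst_prob P); apply: ge0_le_integral => //.
- by move=> t _; rewrite lee_fin (orlicz_ge0 psi_orlicz)// divr_ge0// ltW.
- by apply: measurable_orlicz_cmod; rewrite // invr_ge0 ltW.
move=> t _; rewrite lee_fin (le_trans (orlicz_div psi_orlicz _ _ c1 _))//.
rewrite ler_pdivrMr// mul1r (@le_trans _ _ (psi (Num.max M 0)))//.
  by apply: (orlicz_le psi_orlicz) => //; rewrite le_max fM.
by rewrite lerDr.
Qed.

Hypothesis not_equiv : ~ equivalent_norms X0 (norm2 P) (orlicz_norm P psi).

(** The L^2 norm is always dominated by the Orlicz norm, so only the opposite inequality can fail,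
    and it fails for the constant 1/e. The number [c] is the Orlicz norm up to a factor 2. *)
Lemma exists_unbalanced e : 0 < e -> exists f M c,
  [/\ X0 f, 0 <= M /\ forall t, cmod (f t) <= M, orlicz_bound P psi f c,
      ~ orlicz_bound P psi f (c / 2) & (norm2 P f <= (e * c)%:E)%E].
Proof.
move=> e0; have [K K0 hK] := norm2_le_orlicz P _ psi_orlicz psi_growth.
have [f [X0f hf]] : exists f, X0 f /\
    (e^-1%:E * norm2 P f < orlicz_norm P psi f)%E.
  apply: contrapT => nf; apply: not_equiv; exists K^-1, e^-1.
  split; rewrite ?invr_gt0// => f X0f; split; last first.
    by rewrite leNgt; apply/negP => h; apply: nf; exists f.
  apply: le_ereal_inf_tmp => _ [c fc <-]; rewrite lee_pdivrMl// -EFinM.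
  by apply: hK => //; exact: subspace_cmeasurable.
have [M [g [M0 mg fg gM]]] : exists M g,
    [/\ 0 <= M, cmeasurable g, ae_eq P setT f g & forall t, cmod (g t) <= M].
  by apply: Linfty_bounded; case: X0_subspace => + _ _ _; apply.
have mf := subspace_cmeasurable _ X0f.
have X0g : X0 g by case: X0_subspace => _ _ _; apply; [exact: X0f|by []|by []].
have {hf} hg : (e^-1%:E * norm2 P g < orlicz_norm P psi g)%E.
  rewrite -(ae_eq_norm2 _ _ _ mf mg fg).
  by rewrite /orlicz_norm -(ae_eq_orlicz_bound P _ _ _ psi_orlicz mf mg fg).
have [c0 gc0] := bounded_orlicz_bound g M mg gM.
have : (0 <= e^-1%:E * norm2 P g)%E.
  by rewrite mule_ge0 ?lee_fin ?invr_ge0 ?(ltW e0)// /norm2 Lnorm_ge0.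
move=> /le_lt_trans-/(_ _ hg); have := orlicz_norm_le _ _ gc0.
move En : (orlicz_norm P psi g) hg => n; case: n En => [n||]// En hg _.
rewrite lte_fin => n0.
(* The norm [n] is positive, so some admissible [c] lies below 2 n, and c / 2 < n is not
   admissible. *)
have : (orlicz_norm P psi g < (2 * n)%:E)%E.
  by rewrite En lte_fin ltr_pMl// ltr1n.
move=> /ereal_inf_lt[_ [c gc <-]]; rewrite lte_fin => c2n.
exists g, M, c; split=> //.
  move=> /orlicz_norm_le; rewrite En lee_fin leNgt => /negP; apply.
  by rewrite ltr_pdivrMr// mulrC.
rewrite EFinM -lee_pdivrMl// (le_trans (ltW hg))// -En.
exact: orlicz_norm_le.
Qed.

(** Dividing an unbalanced function by [c] normalises both integrals, and Chebyshev's inequality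
    turns its small L^2 norm into a small set of large values. *)
Lemma exists_spike (delta e : R) : 0 < delta -> 0 < e -> exists f M,
  [/\ X0 f, 0 <= M /\ forall t, cmod (f t) <= M,
      (\int[P]_t (psi (cmod (f t)))%:E <= 1)%E,
      (1 < \int[P]_t (psi (cmod (f t) * 2))%:E)%E
    & (P [set t | (delta <= cmod (f t))%R] <= e%:E)%E].
Proof.
(* Chebyshev's inequality will give the bound r^2, which is at most [e] because r <= 1 and r <=
   e. *)
move=> delta0 e0; set r := Num.min 1 e; have r0 : 0 < r by rewrite lt_min ltr01.
have [f [M [c [X0f [M0 fM] fc nfc f2]]]] :=
  exists_unbalanced (delta * r) (mulr_gt0 delta0 r0).
have mf := subspace_cmeasurable _ X0f.
have [c0 fc1] := fc.
have E t : cmod ((c^-1)%:C%C * f t) = cmod (f t) / c.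
  by rewrite cmodM cmod_real ?invr_ge0 1?ltW// mulrC.
exists (fun t => (c^-1)%:C%C * f t), (M / c); split.
- exact: subspaceZ.
- split=> [|t]; first by rewrite divr_ge0// ltW.
  by rewrite E ler_pM2r// invr_gt0.
- by under eq_integral do rewrite E.
- rewrite ltNge; apply/negP.
  under eq_integral do rewrite E -mulrA -[X in _ * X]invrK invfM invrK.
  by move=> h; apply: nfc; split => //; rewrite divr_gt0.
- rewrite [X in P X](_ : _ = [set t | (delta * c <= cmod (f t))%R]); last first.
    by apply/seteqP; split=> t /=; rewrite E ler_pdivlMr.
  rewrite (le_trans (chebyshev_norm2 P _ _ _ mf _ _ f2))//.
  + by rewrite mulr_gt0.
  + by rewrite !mulr_ge0// ltW.
  have -> : delta * r * c / (delta * c) = r by field; rewrite !gt_eqF.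
  rewrite lee_fin.
  rewrite (@le_trans _ _ r)//; last by rewrite ge_min lexx orbT.
  by rewrite ler_iXnr ?(ltW r0)// /r ge_min lexx.
Qed.

End Unbalanced.

(** * Construction of the spike sequence *)

Set Implicit Arguments.
Unset Strict Implicit.

(** The thresholds have sum [delta] over all [n], so functions taken away from their spike sets add
    up to at most [delta]. *)
Definition spike_set (R : realType) (d : measure_display) (T : measurableType d)
    (delta : R) (f : nat -> T -> R[i]) (n : nat) : set T :=
  [set t | delta * 2^-1 ^+ n.+1 <= cmod (f n t)].

(* [spike_bound_sum] and [spike_prob] make the spikes almost disjoint: on the
   [n]-th spike set the earlier functions add up to less than [B n], and that
   set is so small that [psi (8 * B n)] has a small integral over it. *)
Record spike_sequence (R : realType) (d : measure_display)
    (T : measurableType d) (P : probability T R) (psi : R -> R)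
    (f : nat -> T -> R[i]) (M B : nat -> R) (delta : R) : Prop := {
  spike_delta_gt0 : 0 < delta;
  spike_delta_le1 : delta <= 1;
  spike_psi_delta : psi (2 * delta) <= 4^-1;
  spike_cmeasurable n : cmeasurable (f n);
  spike_bound_ge0 n : 0 <= M n;
  spike_bound n t : cmod (f n t) <= M n;
  spike_bound_sum n : 1 + \sum_(0 <= k < n) M k <= B n;
  spike_growth n x : B n <= x -> psi (x / 2) <= 2^-1 ^+ n.+1 * psi x;
  spike_integral_le n : (\int[P]_t (psi (cmod (f n t)))%:E <= 1)%E;
  spike_integral_gt n : (1 < \int[P]_t (psi (cmod (f n t) * 2))%:E)%E;
  spike_prob n :
    ((psi (8 * B n))%:E * P (spike_set delta f n) <= (4^-1 * 2^-1 ^+ n.+1)%:E)%E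
}.

Unset Implicit Arguments.
Set Strict Implicit.

Section SpikeSequence.
Context {R : realType} {d : measure_display} {T : measurableType d}.
Variables (P : probability T R) (psi : R -> R).

Hypothesis psi_orlicz : orlicz_function psi.
Hypothesis psi_growth : psi (2 * x) / psi x @[x --> +oo] --> +oo.
Variable X0 : set (T -> R[i]).
Hypothesis X0_subspace : linear_subspace_Linfty P X0.
Hypothesis not_equiv : ~ equivalent_norms X0 (norm2 P) (orlicz_norm P psi).

Lemma exists_spike_sequence : exists f M B delta,
  (forall n, X0 (f n)) /\ spike_sequence P psi f M B delta.
Proof.
have q0 n : 0 < 2^-1 ^+ n :> R by rewrite exprn_gt0.
have [delta [d0 d1 dpsi]] :
    exists delta, [/\ 0 < delta, delta <= 1 & psi (2 * delta) <= 4^-1].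
  have p0 : 0 <= psi 1 by rewrite (orlicz_ge0 psi_orlicz).
  have p1 : 1 <= 1 + psi 1 by rewrite lerDl.
  have pp : 0 < 1 + psi 1 by exact: lt_le_trans p1.
  have k1 : 1 <= 4 * (1 + psi 1) by nra.
  (* Here 2 delta = 1 / (4 (1 + psi 1)), where convexity bounds [psi] by psi 1 / (4 (1 + psi 1)) <=
     1/4. *)
  exists ((4 * (1 + psi 1))^-1 / 2); split.
  - by rewrite divr_gt0// invr_gt0 mulr_gt0.
  - by rewrite ler_pdivrMr// mul1r invf_ple ?posrE; nra.
  - rewrite mulrC divfK// -[_^-1]mul1r.
    rewrite (le_trans (orlicz_div psi_orlicz _ _ k1 _))//.
    rewrite invfM mulrCA ger_pMr//.
    by rewrite ler_pdivrMr// mul1r lerDr.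
have [thr hthr] : {thr : nat -> R & forall n x, thr n <= x ->
    psi (x / 2) <= 2^-1 ^+ n.+1 * psi x}.
  apply: (@choice _ _ (fun n b => forall x, b <= x ->
    psi (x / 2) <= 2^-1 ^+ n.+1 * psi x)) => n.
  have [x0 x00 h] := orlicz_doubling psi_orlicz psi_growth (2 ^+ n.+1).
  (* [orlicz_doubling] is applied at x / 2, hence the threshold 2 x0. *)
  exists (2 * x0) => x x0x.
  rewrite exprVn [leRHS]mulrC ler_pdivlMr ?exprn_gt0// [leLHS]mulrC.
  have := h (x / 2); rewrite [2 * (x / 2)]mulrC divfK//; apply.
  by rewrite ler_pdivlMr// mulrC.
(* The n-th function depends on the earlier ones only through the number [b], which will be [B n]; a
   single choice over all pairs (n, b) therefore suffices. The divisor 1 + |psi (8 b)| is made for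
   [spike_prob]. *)
pose good n b (g : (T -> R[i]) * R) := [/\ X0 g.1,
  0 <= g.2 /\ forall t, cmod (g.1 t) <= g.2,
  (\int[P]_t (psi (cmod (g.1 t)))%:E <= 1)%E,
  (1 < \int[P]_t (psi (cmod (g.1 t) * 2))%:E)%E &
  (P [set t | (delta * 2^-1 ^+ n.+1 <= cmod (g.1 t))%R] <=
    (4^-1 * 2^-1 ^+ n.+1 / (1 + `|psi (8 * b)|))%:E)%E].
have [sel hsel] : {sel : nat * R -> (T -> R[i]) * R &
    forall nb, good nb.1 nb.2 (sel nb)}.
  apply: (@choice _ _ (fun nb => good nb.1 nb.2)) => -[n b].
  have [||f [M h]] := exists_spike psi_orlicz psi_growth X0_subspace not_equiv
    (delta * 2^-1 ^+ n.+1) (4^-1 * 2^-1 ^+ n.+1 / (1 + `|psi (8 * b)|)).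
  - by rewrite mulr_gt0.
  - by rewrite divr_gt0 ?mulr_gt0 ?invr_gt0// ltr_pwDl.
  by exists (f, M).
(* The first entry of each maximum ensures [spike_growth]; the second accumulates the bounds of the
   earlier functions, starting from 1. *)
pose fix B n : R := if n is m.+1
  then Num.max (thr n) (B m + (sel (m, B m)).2) else Num.max (thr 0) 1.
pose M n := (sel (n, B n)).2; pose f n := (sel (n, B n)).1.
have BM n : 1 + \sum_(0 <= k < n) M k <= B n.
  elim: n => [|n ih]; first by rewrite big_geq// addr0 /= le_max lexx orbT.
  rewrite big_nat_recr//= addrA le_max; apply/orP; right.
  by rewrite lerD2r.
have M0 n : 0 <= M n by have [_ []] := hsel (n, B n).
have B0 n : 0 <= B n.
  by rewrite (le_trans _ (BM n))// addr_ge0// sumr_ge0.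
exists f, M, B, delta; split=> [n|]; first by have [] := hsel (n, B n).
split=> // n; have [X0f [_ fM] f1 f2 fP] := hsel (n, B n).
- exact: (subspace_cmeasurable X0_subspace).
- exact: fM.
- by move=> x Bx; apply: hthr; rewrite (le_trans _ Bx)//; case: (n) => [|m] /=;
    rewrite le_max lexx.
- exact: f1.
- exact: f2.
have p0 : 0 <= psi (8 * B n) by rewrite (orlicz_ge0 psi_orlicz)// mulr_ge0.
rewrite (@le_trans _ _ ((psi (8 * B n))%:E *
  (4^-1 * 2^-1 ^+ n.+1 / (1 + `|psi (8 * B n)|))%:E)%E)//.
  by rewrite lee_wpmul2l ?lee_fin.
rewrite -EFinM lee_fin ger0_norm// mulrCA ger_pMr ?mulr_gt0 ?invr_gt0//.
by rewrite ler_pdivrMr ?mul1r ?lerDr// ltr_pwDl.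
Qed.

End SpikeSequence.

(** * Geometric series *)

Lemma sum_half_powers {R : realType} N :
  \sum_(0 <= k < N) 2^-1 ^+ k.+1 = 1 - 2^-1 ^+ N :> R.
Proof.
elim: N => [|N ih]; first by rewrite big_geq// expr0 subrr.
by rewrite big_nat_recr//= ih exprS; field.
Qed.

Lemma nneseries_half_powers {R : realType} (c : R) (u : nat -> \bar R) :
  0 <= c ->
  (forall n, (0 <= u n)%E) -> (forall n, (u n <= (c * 2^-1 ^+ n.+1)%:E)%E) ->
  (\sum_(0 <= n <oo) u n <= c%:E)%E.
Proof.
move=> c0 u0 uc; apply: lime_le; first exact: is_cvg_nneseries.
apply: nearW => N.
apply: (@le_trans _ _ (\sum_(0 <= k < N) (c * 2^-1 ^+ k.+1)%:E)%E).
  exact: lee_sum.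
by rewrite sumEFin -mulr_sumr sum_half_powers lee_fin ler_piMr// gerBl.
Qed.

(** * Partial sums of the spikes and their integrable majorant *)

Section Spikes.
Context {R : realType} {d : measure_display} {T : measurableType d}.
Context {P : probability T R} {psi : R -> R}.
Context {f : nat -> T -> R[i]} {M B : nat -> R} {delta : R}.
Hypothesis psi_orlicz : orlicz_function psi.
Hypothesis spikes : spike_sequence P psi f M B delta.

Let A := spike_set delta f.

Lemma spike_prev_ge0 n : 0 <= \sum_(0 <= k < n) M k.
Proof. by rewrite sumr_ge0// => k _; exact: (spike_bound_ge0 spikes). Qed.

Lemma spike_B_ge1 n : 1 <= B n.
Proof.
by rewrite (le_trans _ (spike_bound_sum spikes n))// lerDl spike_prev_ge0.
Qed.

Lemma spike_B_ge0 n : 0 <= B n.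
Proof. exact: le_trans (spike_B_ge1 n). Qed.

Lemma spike_psiB_ge0 n : 0 <= psi (8 * B n).
Proof. by rewrite (orlicz_ge0 psi_orlicz)// mulr_ge0// spike_B_ge0. Qed.

Lemma notin_spike_set n t : ~ A n t -> cmod (f n t) <= delta * 2^-1 ^+ n.+1.
Proof. by move=> /negP; rewrite -ltNge => /ltW. Qed.

Lemma notin_spike_set_half n t : ~ A n t -> cmod (f n t) <= 2^-1 ^+ n.+1.
Proof.
move=> /notin_spike_set/le_trans; apply.
by rewrite ler_piMl ?exprn_ge0 ?invr_ge0// (spike_delta_le1 spikes).
Qed.

(** If [n] is the last index below [N] with t in [A n], the earlier terms add up to at most B n - 1
    and each later one is at most 2^-(k+1). The subtracted 2^-N is the room kept for the indices
    still to come. *)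
Lemma partial_sum_dichotomy N t :
  \sum_(0 <= k < N) cmod (f k t) <= 1 - 2^-1 ^+ N \/
  exists n, A n t /\
    \sum_(0 <= k < N) cmod (f k t) <= B n + cmod (f n t) - 2^-1 ^+ N.
Proof.
elim: N => [|N ih]; first by left; rewrite big_geq// expr0 subrr.
have hq : 2^-1 ^+ N = 2^-1 ^+ N.+1 + 2^-1 ^+ N.+1 :> R by rewrite exprS; field.
rewrite big_nat_recr//=; have [AN|/notin_spike_set_half fN] := pselect (A N t).
  (* A new spike replaces the old index: all earlier terms are bounded through [M], and the slack 1
     in [B N] covers 2^-(N+1). *)
  right; exists N; split=> //.
  have q1 : 2^-1 ^+ N.+1 <= 1 :> R.
    by rewrite exprn_ile1// ?invr_ge0// invf_le1// ler1n.
  have : \sum_(0 <= k < N) cmod (f k t) <= \sum_(0 <= k < N) M k.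
    by apply: ler_sum => k _; exact: (spike_bound spikes).
  have := spike_bound_sum spikes N; lra.
case: ih => [ih|[n [An ih]]]; [left|right; exists n; split=> //]; lra.
Qed.

(** Controls [psi] at points of [A n] where the relevant values are at most 8 B n; [spike_prob]
    makes its integral at most 1/4. *)
Definition spike_mass (t : T) : \bar R :=
  (\sum_(0 <= n <oo) (psi (8 * B n) * \1_(A n) t)%:E)%E.

(** The weights are those gained in [spike_growth]; their sum 1 bounds the integral. *)
Definition orlicz_mass (t : T) : \bar R :=
  (\sum_(0 <= n <oo) (2^-1 ^+ n.+1 * psi (cmod (f n t)))%:E)%E.

(** One summand for each case: no spike, a last spike of height at most [B n], a higher last
    spike. *)
Definition majorant (t : T) : \bar R :=
  ((psi 1)%:E + (spike_mass t + orlicz_mass t))%E.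

Lemma spike_mass_term_ge0 n t : (0 <= (psi (8 * B n) * \1_(A n) t)%:E)%E.
Proof. by rewrite lee_fin mulr_ge0// spike_psiB_ge0. Qed.

Lemma orlicz_mass_term_ge0 n t :
  (0 <= (2^-1 ^+ n.+1 * psi (cmod (f n t)))%:E)%E.
Proof.
by rewrite lee_fin mulr_ge0 ?exprn_ge0 ?invr_ge0 ?(orlicz_ge0 psi_orlicz).
Qed.

Lemma spike_mass_ge0 t : (0 <= spike_mass t)%E.
Proof. by apply: nneseries_ge0 => n _ _; exact: spike_mass_term_ge0. Qed.

Lemma orlicz_mass_ge0 t : (0 <= orlicz_mass t)%E.
Proof. by apply: nneseries_ge0 => n _ _; exact: orlicz_mass_term_ge0. Qed.

Lemma majorant_ge0 t : (0 <= majorant t)%E.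
Proof.
rewrite !adde_ge0 ?spike_mass_ge0 ?orlicz_mass_ge0//.
by rewrite lee_fin (orlicz_ge0 psi_orlicz).
Qed.

Lemma spike_mass_ge n t : A n t -> ((psi (8 * B n))%:E <= spike_mass t)%E.
Proof.
move=> An; apply: le_trans (nneseries_lim_ge n.+1 _); last first.
  by move=> k _ _; exact: spike_mass_term_ge0.
rewrite big_nat_recr//= indicE mem_set// mulr1 leeDr//.
by apply: sume_ge0 => k _; exact: spike_mass_term_ge0.
Qed.

Lemma orlicz_mass_ge n t :
  ((2^-1 ^+ n.+1 * psi (cmod (f n t)))%:E <= orlicz_mass t)%E.
Proof.
apply: le_trans (nneseries_lim_ge n.+1 _); last first.
  by move=> k _ _; exact: orlicz_mass_term_ge0.
rewrite big_nat_recr//= leeDr//.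
by apply: sume_ge0 => k _; exact: orlicz_mass_term_ge0.
Qed.

Lemma psi_partial_sum_le N t :
  ((psi ((\sum_(0 <= k < N) cmod (f k t)) / 4))%:E <= majorant t)%E.
Proof.
set S := \sum_(0 <= k < N) _.
have S0 : 0 <= S by rewrite sumr_ge0.
have q0 : 0 < 2^-1 ^+ N :> R by rewrite exprn_gt0 ?invr_gt0.
have psi0 x : 0 <= x -> 0 <= psi x by exact: (orlicz_ge0 psi_orlicz).
have le_psi := orlicz_le psi_orlicz.
have := partial_sum_dichotomy N t; rewrite -/S => -[S1|[n [An Sn]]].
  rewrite (@le_trans _ _ (psi 1)%:E)//.
    by rewrite lee_fin le_psi//; lra.
  by rewrite leeDl// adde_ge0 ?spike_mass_ge0 ?orlicz_mass_ge0.
have Bn := spike_B_ge0 n; have f0 := cmod_ge0 (f n t).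
apply: (@le_trans _ _ (spike_mass t + orlicz_mass t)%E); last first.
  by rewrite leeDr// lee_fin psi0.
(* The sum is at most 2 B n in the first case and 2 |f_n| in the second, so a quarter of it is at
   most 8 B n, respectively |f_n| / 2. *)
have [fB|/ltW Bf] := leP (cmod (f n t)) (B n).
  rewrite (@le_trans _ _ (spike_mass t))//;
    last by rewrite leeDl// orlicz_mass_ge0.
  rewrite (le_trans _ (spike_mass_ge n t An))// lee_fin le_psi//; first lra.
  lra.
rewrite (@le_trans _ _ (orlicz_mass t))//;
  last by rewrite leeDr// spike_mass_ge0.
rewrite (le_trans _ (orlicz_mass_ge n t))// lee_fin.
rewrite (le_trans _ (spike_growth spikes Bf))// le_psi//; first lra.
lra.
Qed.

Lemma measurable_spike_set n : measurable (A n).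
Proof.
rewrite [X in measurable X](_ : _ = (fun t => cmod (f n t)) @^-1`
    `[delta * 2^-1 ^+ n.+1, +oo[); last first.
  by apply/seteqP; split=> t /=; rewrite in_itv/= andbT.
rewrite -[X in measurable X]setTI; apply: measurable_cmod => //.
exact: (spike_cmeasurable spikes).
Qed.

Lemma measurable_spike_mass_term n :
  measurable_fun setT (fun t => (psi (8 * B n) * \1_(A n) t)%:E).
Proof.
apply/measurable_EFinP/measurable_funM => //.
exact/measurable_indic/measurable_spike_set.
Qed.

Lemma measurable_psi_spike n c : 0 <= c ->
  measurable_fun setT (fun t => (psi (cmod (f n t) * c))%:E).
Proof.
move=> c0; apply: measurable_orlicz_cmod => //.
exact: (spike_cmeasurable spikes).
Qed.

Lemma measurable_orlicz_mass_term n :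
  measurable_fun setT (fun t => (2^-1 ^+ n.+1 * psi (cmod (f n t)))%:E).
Proof.
under eq_fun do rewrite EFinM -[cmod _]mulr1.
by apply: measurable_funeM; exact: measurable_psi_spike.
Qed.

Lemma measurable_spike_mass : measurable_fun setT spike_mass.
Proof.
apply: ge0_emeasurable_sum => [n t _ _|n _]; first exact: spike_mass_term_ge0.
exact: measurable_spike_mass_term.
Qed.

Lemma measurable_orlicz_mass : measurable_fun setT orlicz_mass.
Proof.
apply: ge0_emeasurable_sum => [n t _ _|n _]; first exact: orlicz_mass_term_ge0.
exact: measurable_orlicz_mass_term.
Qed.

Lemma measurable_majorant : measurable_fun setT majorant.
Proof.
apply: emeasurable_funD => //; apply: emeasurable_funD.
- exact: measurable_spike_mass.
- exact: measurable_orlicz_mass.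
Qed.

Lemma integral_spike_mass : (\int[P]_t spike_mass t <= (4^-1)%:E)%E.
Proof.
rewrite integral_nneseries//; first last.
- by move=> n t _; exact: spike_mass_term_ge0.
- exact: measurable_spike_mass_term.
have E n : (\int[P]_t (psi (8 * B n) * \1_(A n) t)%:E =
    (psi (8 * B n))%:E * P (A n))%E.
  under eq_integral do rewrite EFinM.
  rewrite ge0_integralZl_EFin ?spike_psiB_ge0//.
  - by rewrite integral_indic ?setIT//; exact: measurable_spike_set.
  - exact/measurable_EFinP/measurable_indic/measurable_spike_set.
apply: nneseries_half_powers => [|n|n]; first by rewrite invr_ge0.
- by apply: integral_ge0 => t _; exact: spike_mass_term_ge0.
- by rewrite E; exact: (spike_prob spikes).
Qed.

Lemma integral_orlicz_mass : (\int[P]_t orlicz_mass t <= 1)%E.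
Proof.
rewrite integral_nneseries//; first last.
- by move=> n t _; exact: orlicz_mass_term_ge0.
- exact: measurable_orlicz_mass_term.
apply: nneseries_half_powers => [//|n|n].
- by apply: integral_ge0 => t _; exact: orlicz_mass_term_ge0.
under eq_integral do rewrite EFinM -[cmod _]mulr1.
rewrite ge0_integralZl_EFin ?exprn_ge0 ?invr_ge0//.
- under eq_integral do rewrite mulr1.
  rewrite mul1r -[leRHS]mule1 lee_wpmul2l ?lee_fin ?exprn_ge0 ?invr_ge0//.
  exact: (spike_integral_le spikes).
- by move=> t _; rewrite lee_fin (orlicz_ge0 psi_orlicz)// mulr1.
- exact: measurable_psi_spike.
Qed.

Let K := 2 + psi 1.

Lemma integral_majorant : (\int[P]_t majorant t <= K%:E)%E.
Proof.
have psi1 : 0 <= psi 1 by rewrite (orlicz_ge0 psi_orlicz).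
rewrite ge0_integralD//; first last.
- apply: emeasurable_funD; first exact: measurable_spike_mass.
  exact: measurable_orlicz_mass.
- by move=> t _; rewrite adde_ge0 ?spike_mass_ge0 ?orlicz_mass_ge0.
rewrite ge0_integralD//; first last.
- exact: measurable_orlicz_mass.
- by move=> t _; exact: orlicz_mass_ge0.
- exact: measurable_spike_mass.
- by move=> t _; exact: spike_mass_ge0.
rewrite integral_cst_prob.
rewrite (@le_trans _ _ ((psi 1)%:E + ((4^-1)%:E + 1%:E))%E)//.
  by rewrite leeD2l// leeD ?integral_spike_mass ?integral_orlicz_mass.
rewrite -!EFinD lee_fin /K; lra.
Qed.

(** * Absolute convergence almost everywhere *)

Definition good_set : set T := [set t | (majorant t < +oo)%E].

Lemma measurable_good_set : measurable good_set.
Proof.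
rewrite -[X in measurable X]setTI; apply: emeasurable_fun_infty_o => //.
exact: measurable_majorant.
Qed.

Lemma ae_good_set : {ae P, forall t, good_set t}.
Proof.
have h : P.-integrable setT majorant.
  apply/integrableP; split; first exact: measurable_majorant.
  under eq_integral do rewrite gee0_abs ?majorant_ge0//.
  by rewrite (le_lt_trans integral_majorant)// ltry.
apply: filterS (integrable_ae measurableT h) => t /= /(_ I).
by rewrite ge0_fin_numE// majorant_ge0.
Qed.

Definition total_sum (t : T) : R :=
  sup (range (fun N => \sum_(0 <= k < N) cmod (f k t))).

(** A finite [majorant] bounds [psi] at a quarter of every partial sum, and [psi] tends to
    infinity. *)
Lemma good_set_has_sup t : good_set t ->
  has_sup (range (fun N => \sum_(0 <= k < N) cmod (f k t))).
Proof.
move=> Gt; split; first by exists (\sum_(0 <= k < 0) cmod (f k t)), 0%N.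
have [x0 x00 h] := orlicz_unbounded psi_orlicz (fine (majorant t)).
exists (4 * x0) => _ [N _ <-]; rewrite leNgt; apply/negP => lt.
have := h ((\sum_(0 <= k < N) cmod (f k t)) / 4).
rewrite ler_pdivlMr// mulrC => /(_ (ltW lt)).
rewrite ltNge => /negP; apply; rewrite -lee_fin fineK ?psi_partial_sum_le//.
by rewrite ge0_fin_numE// majorant_ge0.
Qed.

Lemma partial_sum_le_total t N : good_set t ->
  \sum_(0 <= k < N) cmod (f k t) <= total_sum t.
Proof. by move=> /good_set_has_sup/sup_upper_bound; apply; exists N. Qed.

Lemma total_sum_ge0 t : good_set t -> 0 <= total_sum t.
Proof. by move=> /(partial_sum_le_total _ 0); rewrite big_geq. Qed.

(** If the total is positive, some partial sum exceeds half of it; this turns the 4 of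
    [psi_partial_sum_le] into 8. *)
Lemma psi_total_sum_le t : good_set t ->
  ((psi (total_sum t / 8))%:E <= majorant t)%E.
Proof.
move=> Gt; have := total_sum_ge0 _ Gt; rewrite le_eqVlt => /predU1P[<-|S0].
  by rewrite mul0r; case: psi_orlicz => _ _ _ -> _; exact: majorant_ge0.
have /sup_gt S2 : total_sum t / 2 < total_sum t.
  by rewrite ltr_pdivrMr// ltr_pMr// ltr1n.
case: S2 => [|_ [N _ <-] hN]; first by case: (good_set_has_sup _ Gt).
apply: le_trans (psi_partial_sum_le N t); rewrite lee_fin.
by apply: (orlicz_le psi_orlicz); lra.
Qed.

(** * The map from c_0 defined by the spikes *)

Definition partial_sum (a : nat -> R[i]) N t : R[i] :=
  \sum_(0 <= k < N) a k * f k t.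

(* Off [good_set] both sequences are zero, so that the limits exist everywhere
   and [c0_map a] is measurable. *)
Definition c0_map (a : nat -> R[i]) (t : T) : R[i] :=
  (limn (fun N => \1_good_set t * complex.Re (partial_sum a N t)) +i*
   limn (fun N => \1_good_set t * complex.Im (partial_sum a N t)))%C.

Lemma dominated_series_cvg (u v : nat -> R) (c S : R) : 0 <= c ->
  (forall k, `|u k| <= c * v k) -> (forall N, \sum_(0 <= k < N) v k <= S) ->
  cvgn (series u).
Proof.
move=> c0 uv vS; apply: normed_cvg; apply: nondecreasing_is_cvgn.
  by apply: nondecreasing_series => k _ _; exact: normr_ge0.
exists (c * S) => _ [N _ <-]; rewrite /series/=.
rewrite (@le_trans _ _ (\sum_(0 <= k < N) c * v k)) ?ler_sum//.
by rewrite -mulr_sumr ler_wpM2l.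
Qed.

Lemma cmod_bound_ge0 (a : nat -> R[i]) s :
  (forall k, cmod (a k) <= s) -> 0 <= s.
Proof. by move/(_ 0%N); exact: le_trans. Qed.

Lemma c0_map_cvgn (a : nat -> R[i]) s t : (forall k, cmod (a k) <= s) ->
  cvgn (fun N => \1_good_set t * complex.Re (partial_sum a N t)) /\
  cvgn (fun N => \1_good_set t * complex.Im (partial_sum a N t)).
Proof.
move=> aS; have s0 := cmod_bound_ge0 _ _ aS.
have [Gt|nG] := pselect (good_set t); last first.
  by split; under eq_fun do rewrite indicE memNset// mul0r; exact: is_cvg_cst.
have E (u : nat -> R) : (fun N => \1_good_set t * u N) = u.
  by apply/funext => N; rewrite indicE mem_set// mul1r.
have S_le N := partial_sum_le_total _ N Gt; rewrite !E /partial_sum; split.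
- under eq_fun do rewrite Re_sum.
  apply: (dominated_series_cvg _ (fun k => cmod (f k t)) s _ s0 _ S_le) => k.
  by rewrite (le_trans (Re_le_cmod _))// cmodM ler_wpM2r.
- under eq_fun do rewrite Im_sum.
  apply: (dominated_series_cvg _ (fun k => cmod (f k t)) s _ s0 _ S_le) => k.
  by rewrite (le_trans (Im_le_cmod _))// cmodM ler_wpM2r.
Qed.

Lemma c0_map_cvg (a : nat -> R[i]) s t : good_set t ->
  (forall k, cmod (a k) <= s) ->
  complex.Re (partial_sum a N t) @[N --> \oo] --> complex.Re (c0_map a t) /\
  complex.Im (partial_sum a N t) @[N --> \oo] --> complex.Im (c0_map a t).
Proof.
move=> Gt aS; have := c0_map_cvgn _ _ t aS; rewrite /c0_map /=.
have E (u : nat -> R) : (fun N => \1_good_set t * u N) = u.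
  by apply/funext => N; rewrite indicE mem_set// mul1r.
by rewrite !E.
Qed.

Lemma c0_map_eq (a : nat -> R[i]) t z : good_set t ->
  complex.Re (partial_sum a N t) @[N --> \oo] --> complex.Re z ->
  complex.Im (partial_sum a N t) @[N --> \oo] --> complex.Im z ->
  c0_map a t = z.
Proof.
move=> Gt; rewrite /c0_map.
have E (u : nat -> R) : (fun N => \1_good_set t * u N) = u.
  by apply/funext => N; rewrite indicE mem_set// mul1r.
rewrite !E => /cvg_lim -> // /cvg_lim -> //; by case: z.
Qed.

(** Closed disks are closed. The squared modulus is used because it is polynomial in the real and
    imaginary parts, whose convergence is known. *)
Lemma c0_map_near (a : nat -> R[i]) s t z r N0 : good_set t ->
  (forall k, cmod (a k) <= s) ->
  (forall N, (N0 <= N)%N -> cmod (partial_sum a N t - z) <= r) ->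
  cmod (c0_map a t - z) <= r.
Proof.
move=> Gt aS h; have [hRe hIm] := c0_map_cvg _ _ _ Gt aS.
have r0 : 0 <= r by exact: le_trans (h _ (leqnn _)).
have h2 : (complex.Re (partial_sum a N t) - complex.Re z) *
      (complex.Re (partial_sum a N t) - complex.Re z) +
    (complex.Im (partial_sum a N t) - complex.Im z) *
      (complex.Im (partial_sum a N t) - complex.Im z) @[N --> \oo] -->
    (complex.Re (c0_map a t) - complex.Re z) *
      (complex.Re (c0_map a t) - complex.Re z) +
    (complex.Im (c0_map a t) - complex.Im z) *
      (complex.Im (c0_map a t) - complex.Im z).
  by apply: cvgD; apply: cvgM; apply: cvgB => //; exact: cvg_cst.
have sq w : cmod (w - z) <= r <->
    (complex.Re w - complex.Re z) * (complex.Re w - complex.Re z) +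
    (complex.Im w - complex.Im z) * (complex.Im w - complex.Im z) <= r ^+ 2.
  rewrite -!expr2 cmodE cReD cReN cImD cImN -{1}(ger0_norm r0) -sqrtr_sqr.
  by rewrite ler_sqrt// exprn_ge0.
apply/sq; apply: cvgr_to_le h2 _.
by exists N0 => // N /h /sq.
Qed.

(** The bound [s0] guarantees convergence, while the estimate uses the bound [s] of the tail, which
    can be taken small for a null sequence. *)
Lemma c0_map_tail (a : nat -> R[i]) s0 s t N : good_set t ->
  (forall k, cmod (a k) <= s0) -> (forall k, (N <= k)%N -> cmod (a k) <= s) ->
  cmod (c0_map a t - partial_sum a N t) <= s * total_sum t.
Proof.
move=> Gt aS0 aS; have s_ge0 : 0 <= s by exact: le_trans (aS _ (leqnn _)).
apply: (c0_map_near _ _ _ _ _ N Gt aS0) => m Nm.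
rewrite /partial_sum (@big_cat_nat _ _ _ N)//= addrAC subrr add0r.
rewrite (le_trans (cmod_sum _ _ _))//.
rewrite (@le_trans _ _ (\sum_(N <= k < m) s * cmod (f k t)))//.
  rewrite !big_nat; apply: ler_sum => k /andP[Nk _].
  by rewrite cmodM ler_wpM2r// aS.
rewrite -mulr_sumr ler_wpM2l// (le_trans _ (partial_sum_le_total _ m Gt))//.
by rewrite [leRHS](@big_cat_nat _ _ _ N)//= lerDr sumr_ge0.
Qed.

(** The terms before [j] contribute at most [s] times the sum of their [M], those after [j] at most
    [s] since [t] is outside their spike sets; [B j] covers both. *)
Lemma c0_map_spike (a : nat -> R[i]) s t j : good_set t ->
  (forall k, cmod (a k) <= s) -> (forall m, (j < m)%N -> ~ A m t) ->
  cmod (c0_map a t - a j * f j t) <= s * B j.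
Proof.
move=> Gt aS nA; have s0 := cmod_bound_ge0 _ _ aS.
apply: (c0_map_near _ _ _ _ _ j.+1 Gt aS) => N jN.
rewrite /partial_sum (@big_cat_nat _ _ _ j.+1)//= big_nat_recr//= addrAC addrK.
rewrite (le_trans (cmodD _ _))//.
rewrite (@le_trans _ _ (s * \sum_(0 <= k < j) M k + s * 1))//; last first.
  by rewrite -mulrDr ler_wpM2l// addrC (spike_bound_sum spikes).
apply: lerD; rewrite (le_trans (cmod_sum _ _ _))//.
  rewrite mulr_sumr; apply: ler_sum => k _; rewrite cmodM ler_pM//.
  exact: (spike_bound spikes).
rewrite (@le_trans _ _ (\sum_(j.+1 <= k < N) s * 2^-1 ^+ k.+1))//.
  rewrite !big_nat; apply: ler_sum => k /andP[jk _].
  by rewrite cmodM ler_pM//; exact/notin_spike_set_half/nA.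
rewrite -mulr_sumr ler_wpM2l//.
rewrite (@le_trans _ _ (\sum_(0 <= k < N) 2^-1 ^+ k.+1))//.
  rewrite [leRHS](@big_cat_nat _ _ _ j.+1)//= lerDr sumr_ge0//.
by rewrite sum_half_powers gerBl exprn_ge0// invr_ge0.
Qed.

Lemma cmeasurable_partial_sum (a : nat -> R[i]) N :
  cmeasurable (partial_sum a N).
Proof.
apply: cmeasurable_sum => k; apply: cmeasurableM; first exact: cmeasurable_cst.
exact: (spike_cmeasurable spikes).
Qed.

Lemma cmeasurable_c0_map (a : nat -> R[i]) s :
  (forall k, cmod (a k) <= s) -> cmeasurable (c0_map a).
Proof.
move=> aS; have mG : measurable_fun setT (\1_good_set : T -> R).
  exact/measurable_indic/measurable_good_set.
split.
- apply: (@measurable_fun_cvg _ _ _ _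
    (fun N t => \1_good_set t * complex.Re (partial_sum a N t))).
    move=> N; apply: measurable_funM => //.
    by have [] := cmeasurable_partial_sum a N.
  by move=> t _; have [] := c0_map_cvgn _ _ t aS.
- apply: (@measurable_fun_cvg _ _ _ _
    (fun N t => \1_good_set t * complex.Im (partial_sum a N t))).
    move=> N; apply: measurable_funM => //.
    by have [] := cmeasurable_partial_sum a N.
  by move=> t _; have [] := c0_map_cvgn _ _ t aS.
Qed.

(** * Upper and lower norm estimates *)

Lemma cmeasurable_c0_map_tail (a : nat -> R[i]) s N :
  (forall k, cmod (a k) <= s) ->
  cmeasurable (fun t => c0_map a t - partial_sum a N t).
Proof.
move=> aS; under eq_fun do rewrite -mulN1r.
apply: cmeasurableD; first exact: cmeasurable_c0_map aS.
apply: cmeasurableM; first exact: cmeasurable_cst.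
exact: cmeasurable_partial_sum.
Qed.

(** Division by [K] normalises the integral of [majorant], and convexity moves it inside [psi]; the
    8 comes from [psi_total_sum_le]. N = 0 gives the upper c_0 estimate, large N the approximation
    by partial sums. *)
Lemma c0_map_tail_bound (a : nat -> R[i]) s0 s N C :
  (forall k, cmod (a k) <= s0) -> (forall k, (N <= k)%N -> cmod (a k) <= s) ->
  0 < C -> s * (8 * K) <= C ->
  orlicz_bound P psi (fun t => c0_map a t - partial_sum a N t) C.
Proof.
move=> aS0 aS C0 sC; split=> //.
have s_ge0 : 0 <= s by exact: le_trans (aS _ (leqnn _)).
have psi1 : 0 <= psi 1 by rewrite (orlicz_ge0 psi_orlicz).
have K1 : 1 <= K by rewrite /K; lra.
have K0 : 0 < K by exact: lt_le_trans K1.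
rewrite (@le_trans _ _ (\int[P]_t ((K^-1)%:E * majorant t))%E)//; last first.
  rewrite ge0_integralZl_EFin ?invr_ge0 ?(ltW K0)//.
  - by rewrite lee_pdivrMl// mule1 integral_majorant.
  - by move=> t _; exact: majorant_ge0.
  - exact: measurable_majorant.
apply: ge0_le_integral => //.
- by move=> t _; rewrite lee_fin (orlicz_ge0 psi_orlicz)// divr_ge0// ltW.
- apply: measurable_orlicz_cmod; rewrite // ?invr_ge0 ?ltW//.
  exact: cmeasurable_c0_map_tail aS0.
- by apply: measurable_funeM; exact: measurable_majorant.
(* Off [good_set] the right-hand side is infinite. *)
move=> t _; have [Gt|] := pselect (good_set t); last first.
  rewrite /good_set/= => /negP; rewrite -leNgt leye_eq => /eqP ->.
  by rewrite gt0_muley ?leey// lte_fin invr_gt0.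
have S0 := total_sum_ge0 _ Gt.
rewrite lee_pdivlMl// (le_trans _ (psi_total_sum_le _ Gt))//.
rewrite -EFinM lee_fin -ler_pdivlMl// [leRHS]mulrC.
have S8 : 0 <= total_sum t / 8 by rewrite divr_ge0.
rewrite (le_trans _ (orlicz_div psi_orlicz _ _ K1 S8))//.
apply: (orlicz_le psi_orlicz); first by rewrite divr_ge0// ltW.
rewrite ler_pdivrMr// (le_trans (c0_map_tail _ _ _ _ _ Gt aS0 aS))//.
have -> : s * total_sum t = total_sum t / 8 / K * (s * (8 * K)).
  by field; rewrite gt_eqF.
by rewrite ler_wpM2l// divr_ge0// ltW.
Qed.

(** Off [A j], the bound psi (2 delta) <= 1/4 suffices. On [A j], [spike_mass] suffices if |f_j| <=
    4 B j, and also if a later [A m] contains [t], as then |f_j| <= M j <= B m. Otherwise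
    [c0_map_spike] shows that a_j f_j is the dominant term. *)
Lemma psi_spike_le (a : nat -> R[i]) s c t j : good_set t ->
  (forall k, cmod (a k) <= s) -> s <= 2 * cmod (a j) -> 0 < c ->
  8 * c <= cmod (a j) ->
  ((psi (cmod (f j t) * 2))%:E <=
    (2^-1 * psi (cmod (c0_map a t) / c))%:E + ((4^-1)%:E + spike_mass t))%E.
Proof.
move=> Gt aS saj c0 caj.
have psi0 x : 0 <= x -> 0 <= psi x by exact: (orlicz_ge0 psi_orlicz).
have le_psi := orlicz_le psi_orlicz.
have f0 := cmod_ge0 (f j t).
have J0 : 0 <= 2^-1 * psi (cmod (c0_map a t) / c).
  by rewrite mulr_ge0 ?psi0// divr_ge0// ltW.
have [Aj|/notin_spike_set fj] := pselect (A j t); last first.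
  rewrite (@le_trans _ _ (4^-1)%:E)//; last first.
    rewrite (@le_trans _ _ ((4^-1)%:E + spike_mass t)%E)//.
      by rewrite leeDl// spike_mass_ge0.
    by rewrite leeDr// lee_fin.
  rewrite lee_fin (le_trans _ (spike_psi_delta spikes))// le_psi//.
    by rewrite mulr_ge0.
  rewrite mulrC ler_pM2l// (le_trans fj)// ler_piMr//.
    by rewrite ltW// (spike_delta_gt0 spikes).
  by rewrite exprn_ile1// ?invr_ge0// invf_le1// ler1n.
have small x : (x%:E <= spike_mass t)%E -> (x%:E <=
    (2^-1 * psi (cmod (c0_map a t) / c))%:E + ((4^-1)%:E + spike_mass t))%E.
  move=> /le_trans; apply.
  rewrite (@le_trans _ _ ((4^-1)%:E + spike_mass t)%E)//.
    by rewrite leeDr// lee_fin invr_ge0.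
  by rewrite leeDr// lee_fin.
have [Bf|/ltW fB] := leP (4 * B j) (cmod (f j t)); last first.
  apply: small; apply: le_trans (spike_mass_ge _ _ Aj).
  by rewrite lee_fin le_psi ?mulr_ge0//; lra.
have [[m [jm Am]]|nA] := pselect (exists m, (j < m)%N /\ A m t).
  apply: small; apply: le_trans (spike_mass_ge _ _ Am).
  rewrite lee_fin le_psi ?mulr_ge0//.
  have fM := spike_bound spikes j t.
  have : M j <= \sum_(0 <= k < m) M k.
    rewrite (@big_cat_nat _ _ _ j.+1)//= big_nat_recr//= addrAC lerDr.
    rewrite addr_ge0 ?spike_prev_ge0// sumr_ge0// => k _.
    exact: (spike_bound_ge0 spikes).
  by have := spike_bound_sum spikes m; have := spike_B_ge0 m; lra.
have {nA} nA m : (j < m)%N -> ~ A m t by move=> jm Am; apply: nA; exists m.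
have hJ := c0_map_spike _ _ _ _ Gt aS nA.
(* The error s B j <= 2 |a_j| B j is at most half of |a_j f_j|, and 8 c <= |a_j| makes the other
   half at least 4 c |f_j|. *)
have {hJ} hJ : 4 * cmod (f j t) <= cmod (c0_map a t) / c.
  rewrite ler_pdivlMr//.
  have := cmodB (a j * f j t) (a j * f j t - c0_map a t).
  rewrite subKr -[cmod (_ - c0_map a t)]cmodN opprB cmodM => h.
  have Bj := spike_B_ge0 j; have aj := cmod_ge0 (a j).
  nra.
rewrite (@le_trans _ _ (2^-1 * psi (cmod (c0_map a t) / c))%:E)//; last first.
  by rewrite leeDl// adde_ge0 ?spike_mass_ge0// lee_fin invr_ge0.
(* Writing 2 as 1/2 times 4 lets convexity produce the factor 1/2 in front of [psi]. *)
have -> : cmod (f j t) * 2 = 2^-1 * (4 * cmod (f j t)) by field.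
rewrite lee_fin (le_trans (orlicz_scale psi_orlicz _ _ _ _ _))//.
- by rewrite invf_le1// ler1n.
- by rewrite mulr_ge0.
- by rewrite ler_pM2l// le_psi// mulr_ge0.
Qed.

(** If |a_j| > 8 c, integrating [psi_spike_le] bounds the integral of psi (2 |f_j|) by 1/2 + 1/4 +
    1/4 = 1, against [spike_integral_gt]. *)
Lemma c0_map_lower (a : nat -> R[i]) s c j :
  (forall k, cmod (a k) <= s) -> s <= 2 * cmod (a j) ->
  orlicz_bound P psi (c0_map a) c -> cmod (a j) <= 8 * c.
Proof.
move=> aS saj [c0 Jc]; rewrite leNgt; apply/negP => /ltW caj.
have := spike_integral_gt spikes j; rewrite ltNge => /negP; apply.
have mJ : measurable_fun setT (fun t => (psi (cmod (c0_map a t) / c))%:E).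
  apply: measurable_orlicz_cmod; rewrite // ?invr_ge0 ?ltW//.
  exact: cmeasurable_c0_map aS.
have J0 t : (0 <= (psi (cmod (c0_map a t) / c))%:E)%E.
  by rewrite lee_fin (orlicz_ge0 psi_orlicz)// divr_ge0// ltW.
have m2J : measurable_fun setT
    (fun t => (2^-1 * psi (cmod (c0_map a t) / c))%:E).
  by under eq_fun do rewrite EFinM; exact: measurable_funeM.
have J20 t : (0 <= (2^-1 * psi (cmod (c0_map a t) / c))%:E)%E.
  by rewrite EFinM mule_ge0.
have V0 t : (0 <= (4^-1)%:E + spike_mass t)%E.
  by rewrite adde_ge0 ?spike_mass_ge0// lee_fin invr_ge0.
have mV : measurable_fun setT (fun t => (4^-1)%:E + spike_mass t)%E.
  by apply: emeasurable_funD => //; exact: measurable_spike_mass.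
apply: (@le_trans _ _ (\int[P]_t ((2^-1 * psi (cmod (c0_map a t) / c))%:E +
  ((4^-1)%:E + spike_mass t)))%E).
  apply: ae_ge0_le_integral => //.
  - by move=> t _; rewrite lee_fin (orlicz_ge0 psi_orlicz)// mulr_ge0.
  - exact: measurable_psi_spike.
  - by move=> t _; rewrite adde_ge0.
  - exact: emeasurable_funD.
  by apply: filterS ae_good_set => t Gt _; exact: psi_spike_le aS saj c0 caj.
rewrite ge0_integralD// ge0_integralD//; first last.
- exact: measurable_spike_mass.
- by move=> t _; exact: spike_mass_ge0.
rewrite integral_cst_prob; under eq_integral do rewrite EFinM.
rewrite ge0_integralZl_EFin//.
apply: (@le_trans _ _ ((2^-1)%:E * 1 + ((4^-1)%:E + (4^-1)%:E))%E).
  by rewrite leeD ?leeD2l ?integral_spike_mass// lee_wpmul2l.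
by rewrite mule1 -!EFinD lee_fin; lra.
Qed.

(** * Linearity and the images of the basis vectors *)

Lemma c0_map_linear (k : R[i]) (a b : nat -> R[i]) s1 s2 t : good_set t ->
  (forall n, cmod (a n) <= s1) -> (forall n, cmod (b n) <= s2) ->
  c0_map (fun n => k * a n + b n) t = k * c0_map a t + c0_map b t.
Proof.
move=> Gt aS bS; have [aR aI] := c0_map_cvg _ _ _ Gt aS.
have [bR bI] := c0_map_cvg _ _ _ Gt bS.
have E N : partial_sum (fun n => k * a n + b n) N t =
    k * partial_sum a N t + partial_sum b N t.
  rewrite /partial_sum mulr_sumr -big_split/=; apply: eq_bigr => n _.
  by rewrite mulrDl mulrA.
apply: c0_map_eq => //; under eq_fun do rewrite E.
- under eq_fun do rewrite cReD cReM; rewrite cReD cReM.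
  by apply: cvgD => //; apply: cvgB; apply: cvgM => //; exact: cvg_cst.
- under eq_fun do rewrite cImD cImM; rewrite cImD cImM.
  by apply: cvgD => //; apply: cvgD; apply: cvgM => //; exact: cvg_cst.
Qed.

Lemma c0_map_basis n t : good_set t -> c0_map (c0_basis R n) t = f n t.
Proof.
move=> Gt; have a1 k : cmod (c0_basis R n k : R[i]) <= 1.
  by rewrite /c0_basis; case: eqP; rewrite ?cmod1 ?cmod0.
apply/eqP; rewrite -subr_eq0; apply/eqP; apply: ComplexField.Normc.eq0_normc.
apply/le_anti/andP; split; last exact: cmod_ge0.
(* The radius is 0: every partial sum containing the index [n] equals [f n t]. *)
apply: (c0_map_near _ _ _ _ _ n.+1 Gt a1) => N nN.
rewrite /partial_sum (bigD1_seq n)/= ?mem_index_iota ?iota_uniq//.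
rewrite big1 => [|k /negPf kn]; last by rewrite /c0_basis kn mul0r.
by rewrite /c0_basis eqxx mul1r addr0 subrr cmod0.
Qed.

End Spikes.

(** * The supremum norm on c_0 and the equivalence of sequences *)

Lemma c0_sup_norm {R : realType} (a : nat -> R[i]) : c0_space a ->
  exists s, [/\ 0 <= s, sup_norm a = s%:E, forall k, cmod (a k) <= s
    & forall r, r < s -> exists j, r < cmod (a j)].
Proof.
(* A null sequence is bounded, so the extended real supremum is a real number. *)
move=> a0; have [S aS] : exists S, forall k, cmod (a k) <= S.
  have /cvg_seq_bounded/pinfty_ex_gt0[S _ hS] : cvgn (fun n => cmod (a n)).
    by apply/cvg_ex; exists 0.
  by exists S => k; have := hS k I; rewrite /= ger0_norm.
have s_ge k : ((cmod (a k))%:E <= sup_norm a)%E.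
  by apply: ereal_sup_ubound; exists k.
have : (sup_norm a <= S%:E)%E.
  by apply: ge_ereal_sup => _ [k _ <-]; rewrite lee_fin.
have := s_ge 0%N; case E : (sup_norm a) => [s||]// s0 _.
exists s; split=> // [|k|r rs].
- by rewrite -lee_fin (le_trans _ s0)// lee_fin.
- by have := s_ge k; rewrite E lee_fin.
have : (r%:E < sup_norm a)%E by rewrite E lte_fin.
by move=> /ereal_sup_gt[_ [j _ <-]]; rewrite lte_fin; exists j.
Qed.

Theorem theorem2p1 (R : realType) (d : measure_display) (T : measurableType d)
    (P : probability T R) (psi : R -> R) (X0 : set (T -> R[i]))
    (psi_orlicz : orlicz_function psi)
    (psi_growth : psi (2 * x) / psi x @[x --> +oo] --> +oo)
    (X0_subspace : linear_subspace_Linfty P X0)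
    (not_equiv : ~ equivalent_norms X0 (norm2 P) (orlicz_norm P psi)) :
  exists f : nat -> T -> R[i],
    (forall n, X0 (f n)) /\
    equivalent_to_c0_basis P psi (orlicz_closure P psi X0) f.
Proof.
have [f [M [B [delta [X0f spikes]]]]] :=
  exists_spike_sequence P psi psi_orlicz psi_growth X0 X0_subspace not_equiv.
exists f; split=> //.
pose J := c0_map (psi := psi) (f := f) (B := B) (delta := delta).
have ae_good := ae_good_set psi_orlicz spikes.
set K := 8 * (2 + psi 1).
have K0 : 0 < K.
  by rewrite mulr_gt0// ltr_wpDr// (orlicz_ge0 psi_orlicz).
have J_tail := c0_map_tail_bound psi_orlicz spikes.
have J_bound (a : nat -> R[i]) s C : (forall k, cmod (a k) <= s) ->
    0 < C -> s * K <= C -> orlicz_bound P psi (J a) C.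
  (* The tail from index 0 is the whole of [J a]. *)
  move=> aS C0 sC; have := J_tail a s s 0%N C aS (fun k _ => aS k) C0 sC.
  by under eq_fun do rewrite /partial_sum big_geq// subr0.
exists J; split.
- move=> a a0; have [s [s0 _ aS _]] := c0_sup_norm a a0; split.
    split; first exact: (cmeasurable_c0_map psi_orlicz spikes) aS.
    (* Adding 1 keeps the constant positive when s = 0. *)
    exists (s * K + 1); apply: J_bound aS _ _; last by rewrite lerDl.
    by rewrite ltr_wpDl// mulr_ge0// ltW.
  (* Partial sums lie in [X0]; once the remaining coefficients are at most e / 2 / K, the tail has
     norm at most e / 2. *)
  move=> e e0; have e2K : 0 < e / 2 / K by rewrite !divr_gt0.
  have /cvgrPdist_le/(_ _ e2K)[N _ aN] := a0.
  have {}aN k : (N <= k)%N -> cmod (a k) <= e / 2 / K.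
    by move=> /aN; rewrite /= sub0r normrN ger0_norm.
  exists (fun t => partial_sum (f := f) a N t).
    exact: (subspace_sum X0_subspace).
  apply: (@le_lt_trans _ _ (e / 2)%:E); last first.
    by rewrite lte_fin ltr_pdivrMr// ltr_pMr// ltr1n.
  apply: orlicz_norm_le; apply: J_tail aS aN _ _; first by rewrite divr_gt0.
  by rewrite divfK// gt_eqF.
- move=> k a b a0 b0; have [s1 [_ _ aS _]] := c0_sup_norm a a0.
  have [s2 [_ _ bS _]] := c0_sup_norm b b0.
  apply: filterS ae_good => t Gt _.
  exact: (c0_map_linear psi_orlicz spikes) Gt aS bS.
(* 1/16 combines the 1/2 lost in choosing a nearly maximal |a_j| with the 1/8 from
   [c0_map_lower]. *)
- exists 16^-1, K; split; rewrite ?invr_gt0// => a a0.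
  have [s [s0 -> aS sa]] := c0_sup_norm a a0; split.
    apply: le_ereal_inf_tmp => _ [c Jc <-]; rewrite -EFinM lee_fin.
    move: s0; rewrite le_eqVlt => /predU1P[<-|s0].
      by rewrite mulr0; case: Jc => /ltW.
    have [j aj] : exists j, s / 2 < cmod (a j).
      by apply: sa; rewrite ltr_pdivrMr// ltr_pMr// ltr1n.
    have : cmod (a j) <= 8 * c.
      by apply: (c0_map_lower psi_orlicz spikes) aS _ Jc; lra.
    by move: aj; lra.
  (* Admissible constants are positive while s K may be 0, so the bound is approached from above. *)
  apply/lee_addgt0Pr => e e0; rewrite -EFinM -EFinD; apply: orlicz_norm_le.
  apply: J_bound aS _ _; last by rewrite mulrC lerDl ltW.
  by rewrite ltr_wpDl// mulr_ge0// ltW.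
- move=> n; apply: filterS ae_good => t Gt _.
  exact: (c0_map_basis psi_orlicz spikes).
Qed.
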